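(* Let $n$ be a positive integer relatively prime to $10$. Then $n$ is a strong Lucas probable prime for Method A if and only if $n$ is a strong Lucas probable prime for Method A*.
   Context: For integers $P > 0$ and $Q$ with $D = P^2 - 4Q \ne 0$, the Lucas sequences $U_j(P,Q)$, $V_j(P,Q)$ are defined by $U_0 = 0$, $U_1 = 1$, $V_0 = 2$, $V_1 = P$, and $U_j = PU_{j-1} - QU_{j-2}$, $V_j = PV_{j-1} - QV_{j-2}$ for $j \ge 2$. Method A: let $D$ be the first element of the sequence $5, -7, 9, -11, 13, -15, \ldots$ (i.e. $(-1)^{j}(2j+5)$ for $j = 0,1,2,\dots$) for which the Jacobi symbol $(D/n) = -1$, and set $P = 1$, $Q = (1-D)/4$. Method A*: choose $D, P, Q$ as in Method A, but if $Q = -1$ (i.e. $D = 5$), replace $P$ and $Q$ both by $5$ (so $D$ is unchanged). Write $n + 1 = d \cdot 2^s$ with $d$ odd. We say $n$ is a strong Lucas probable prime for a method if the method produces parameters $P, Q$ (so $(D/n) = -1$) and either $U_d(P,Q) \equiv 0 \pmod n$ or $V_{d\cdot 2^r}(P,Q) \equiv 0 \pmod n$ for some $r$ with $0 \le r < s$. *)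

(* Defs.v *)
From mathcomp Require Import all_boot all_order all_algebra.

Set Implicit Arguments.
Unset Strict Implicit.
Unset Printing Implicit Defensive.

Import Order.TTheory GRing.Theory Num.Theory.
Local Open Scope ring_scope.

Fixpoint lucasU (P Q : int) (j : nat) : int :=
  match j with
  | 0 => 0
  | 1 => 1
  | (j''.+1 as j').+1 => P * lucasU P Q j' - Q * lucasU P Q j''
  end.

Fixpoint lucasV (P Q : int) (j : nat) : int :=
  match j with
  | 0 => 2
  | 1 => P
  | (j''.+1 as j').+1 => P * lucasV P Q j' - Q * lucasV P Q j''
  end.

(* Meaningful for p an odd prime. *)
Definition legendre (a : int) (p : nat) : int :=
  if (p%:Z %| a)%Z then 0
  else if [exists x : 'I_p, (((x : nat)%:Z ^+ 2)%R == a %[mod p%:Z])%Z] then 1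
  else -1.

(* Meaningful for n odd and positive; the empty product gives (a/1) = 1. *)
Definition jacobi (a : int) (n : nat) : int :=
  \prod_(p <- primes n) legendre a p ^+ logn p n.

(* A selection method relates n to the parameters D, P, Q it produces; it may
   produce none (e.g. if n is a perfect square). *)
Definition lucas_method := nat -> int -> int -> int -> Prop.

Definition seqD (j : nat) : int := (-1) ^+ j * (2 * j + 5)%N%:Z.

Definition firstD (n : nat) (D : int) : Prop :=
  exists j : nat, [/\ D = seqD j, jacobi D n = -1
    & forall i : nat, (i < j)%N -> jacobi (seqD i) n <> -1].

(* Every term of seqD is 1 modulo 4, so the division by 4 is exact. *)
Definition methodA : lucas_method := fun n D P Q =>
  [/\ firstD n D, P = 1 & Q = ((1 - D) %/ 4)%Z].

Definition methodAstar : lucas_method := fun n D P Q =>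
  exists P0 Q0 : int, methodA n D P0 Q0 /\
    (P, Q) = (if Q0 == -1 then (5, 5) else (P0, Q0)).

Definition strong_lucas_probable_prime (M : lucas_method) (n : nat) : Prop :=
  exists D P Q : int, M n D P Q /\
  exists d s : nat, [/\ odd d, n.+1 = (d * 2 ^ s)%N
    & (lucasU P Q d = 0 %[mod n%:Z])%Z \/
      exists r : nat, (r < s)%N /\ (lucasV P Q (d * 2 ^ r)%N = 0 %[mod n%:Z])%Z].

(* Main.v *)
Require Import Defs.
From mathcomp Require Import all_boot all_order all_algebra.
From mathcomp Require Import ring.

(** The methods differ only at Q = -1, where (1, -1) is replaced by (5, 5).  If
    a, b are the roots of x^2 - x - 1, those of x^2 - 5x + 5 are sqrt 5 * a and
    - sqrt 5 * b.  Hence, up to a power of 5 (invertible modulo n), U and V are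
    unchanged at even indices and exchanged at odd ones.  As n + 1 is even, both
    U_d and V_d occur in the strong test, so the exchange does not affect it. *)

Import Order.TTheory GRing.Theory Num.Theory.
Local Open Scope ring_scope.

Lemma lucasU_SS (P Q : int) (m : nat) :
  lucasU P Q m.+2 = P * lucasU P Q m.+1 - Q * lucasU P Q m.
Proof. by []. Qed.

Lemma lucasV_SS (P Q : int) (m : nat) :
  lucasV P Q m.+2 = P * lucasV P Q m.+1 - Q * lucasV P Q m.
Proof. by []. Qed.

(** Both sides obey the same second-order recurrence. Eliminating V turns the mixed identities below
    into polynomial identities in two consecutive U's. *)
Lemma lucasV_lucasU (P Q : int) (m : nat) :
  lucasV P Q m = 2 * lucasU P Q m.+1 - P * lucasU P Q m.
Proof.
suff: lucasV P Q m = 2 * lucasU P Q m.+1 - P * lucasU P Q m /\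
      lucasV P Q m.+1 = 2 * lucasU P Q m.+2 - P * lucasU P Q m.+1 by case.
elim: m => [|m [IH0 IH1]]; first by rewrite /=; split; ring.
by split=> //; rewrite lucasV_SS IH1 IH0 !lucasU_SS; ring.
Qed.

(** Both discriminants are 5, so each U is a difference of powers of roots divided by sqrt 5; at odd
    indices this divisor cancels the leftover sqrt 5. *)
Lemma lucasU55 (k : nat) :
  lucasU 5 5 k.*2 = 5 ^+ k * lucasU 1 (-1) k.*2 /\
  lucasU 5 5 k.*2.+1 = 5 ^+ k * lucasV 1 (-1) k.*2.+1.
Proof.
elim: k => [|k [IH0 IH1]]; first by [].
rewrite doubleS; rewrite !lucasV_lucasU in IH1 *.
by split; rewrite !lucasU_SS IH0 IH1 !lucasU_SS exprS; ring.
Qed.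

(** V has no such divisor: at odd indices the leftover sqrt 5, times the one hidden in U, gives the
    extra factor 5. *)
Lemma lucasV55 (k : nat) :
  lucasV 5 5 k.*2 = 5 ^+ k * lucasV 1 (-1) k.*2 /\
  lucasV 5 5 k.*2.+1 = 5 ^+ k.+1 * lucasU 1 (-1) k.*2.+1.
Proof.
have [U0 U1] := lucasU55 k; have [U2 _] := lucasU55 k.+1.
rewrite doubleS in U2.
by split; rewrite lucasV_lucasU ?U2 U1 ?U0 !lucasV_lucasU !lucasU_SS ?exprS; ring.
Qed.

Lemma eqz_mod0_expMl (n : nat) (a x : int) (k : nat) : coprimez n a ->
  (a ^+ k * x = 0 %[mod n])%Z <-> (x = 0 %[mod n])%Z.
Proof.
move=> co_na.
have mod0 y : (y = 0 %[mod n])%Z <-> (n %| y)%Z.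
  by rewrite -[y in (_ %| y)%Z]subr0 -eqz_mod_dvd; split=> /eqP.
by rewrite !mod0 Gauss_dvdzr // coprimezXr.
Qed.

Definition strong_lucas_test (P Q : int) (n d s : nat) : Prop :=
  (lucasU P Q d = 0 %[mod n%:Z])%Z \/
  exists r : nat, (r < s)%N /\ (lucasV P Q (d * 2 ^ r)%N = 0 %[mod n%:Z])%Z.

(** The condition [0 < s] admits r = 0, so V_d is tested and can trade places with U_d. *)
Lemma strong_lucas_test55 (n d s : nat) :
  coprime n 5 -> odd d -> (0 < s)%N ->
  strong_lucas_test 1 (-1) n d s <-> strong_lucas_test 5 5 n d s.
Proof.
move=> co_n5 odd_d s_gt0.
have mod5 x k := eqz_mod0_expMl n 5 x k co_n5.
have Ud : (lucasU 5 5 d = 0 %[mod n])%Z <-> (lucasV 1 (-1) d = 0 %[mod n])%Z.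
  by rewrite -(odd_double_half d) odd_d (lucasU55 _).2.
have Vd : (lucasV 5 5 d = 0 %[mod n])%Z <-> (lucasU 1 (-1) d = 0 %[mod n])%Z.
  by rewrite -(odd_double_half d) odd_d (lucasV55 _).2.
(* From r = 1 on the index is even, so no exchange occurs. *)
have VdS r : (lucasV 5 5 (d * 2 ^ r.+1)%N = 0 %[mod n])%Z <->
             (lucasV 1 (-1) (d * 2 ^ r.+1)%N = 0 %[mod n])%Z.
  by rewrite expnS mulnCA mul2n (lucasV55 _).1.
split=> -[U_0 | [[|r] [lt_rs V_0]]].
- by right; exists 0%N; rewrite muln1 Vd.
- by left; rewrite muln1 in V_0; rewrite Ud.
- by right; exists r.+1; rewrite VdS.
- by right; exists 0%N; rewrite muln1 -Ud.
- by left; rewrite muln1 in V_0; rewrite -Vd.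
- by right; exists r.+1; rewrite -VdS.
Qed.

Theorem theorem4 (n : nat) (n_gt0 : (0 < n)%N) (co_n10 : coprime n 10) :
  strong_lucas_probable_prime methodA n <->
  strong_lucas_probable_prime methodAstar n.
Proof.
move: co_n10; rewrite (coprimeMr n 2 5) coprimen2 => /andP[odd_n co_n5].
(* With s = 0, n + 1 would equal the odd d, although n is odd. *)
have s_gt0 d s : odd d -> n.+1 = (d * 2 ^ s)%N -> (0 < s)%N.
  by case: s => // odd_d; rewrite muln1 => def_d; rewrite -def_d /= odd_n in odd_d.
split=> [[D [P [Q [methA [d [s [odd_d def_n test]]]]]]] |
         [D [P [Q [[P0 [Q0 [methA PQ]]] [d [s [odd_d def_n test]]]]]]]].
  have [_ P1 _] := methA.
  have [Qm1|nQm1] := eqVneq Q (-1); last first.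
    exists D, P, Q; split; last by exists d, s.
    by exists P, Q; rewrite (negbTE nQm1).
  (* The final [-Qm1] restores [Q] inside [methodA], so that [methA] applies. *)
  exists D, 5, 5; split; first by exists P, Q; rewrite Qm1 eqxx -Qm1.
  exists d, s; split=> //; rewrite P1 Qm1 in test.
  by apply/(strong_lucas_test55 _ _ _ co_n5 odd_d (s_gt0 d s odd_d def_n)).
have [_ P1 _] := methA.
exists D, P0, Q0; split=> //; exists d, s; split=> //.
have [Qm1|nQm1] := eqVneq Q0 (-1); last first.
  by move: PQ; rewrite (negbTE nQm1) => -[<- <-].
move: PQ; rewrite Qm1 eqxx P1 => -[P5 Q5]; rewrite P5 Q5 in test.
by apply/(strong_lucas_test55 _ _ _ co_n5 odd_d (s_gt0 d s odd_d def_n)).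
Qed.
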